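(* Let $\mathcal X_1,\mathcal X_2,\mathcal Y_1,\mathcal Y_2,\mathcal W_1,\mathcal W_2$ be finite nonempty sets, let $g_1:\mathcal W_1\times\mathcal X_1\to[0,1]$ and $g_2:\mathcal W_2\times\mathcal X_2\to[0,1]$ be gain functions, and let $g:(\mathcal W_1\times\mathcal W_2)\times(\mathcal X_1\times\mathcal X_2)\to[0,1]$ be a joint gain function for $g_1,g_2$. Let $\pi$ be a jointly supported prior on $\mathcal X_1\times\mathcal X_2$ with marginals $\pi_1$ and $\pi_2$, with $V_g(\pi)>0$. Let $(\mathcal X_1,\mathcal Y_1,C_1)$ and $(\mathcal X_2,\mathcal Y_2,C_2)$ be two channels. Then: (1) $I_g(\pi,C_1\times C_2)\ \ge\ I_{g_1}(\pi_1,C_1)+I_{g_2}(\pi_2,C_2)-\log\frac{M^{\max}_{g,\pi}}{M^{\min}_{g,\pi}}$; (2) $I_g(\pi,C_1\times C_2)\ \le\ I_{g_1}(\pi_1,C_1)+I_{g_2}(\pi_2,C_2)+\log\frac{M^{\max}_{g,\pi}}{M^{\min}_{g,\pi}}$.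
   Context: A (discrete) channel $(\mathcal X,\mathcal Y,C)$ consists of finite sets $\mathcal X,\mathcal Y$ and a matrix $C$ with entries $C[x,y]\ge 0$ and $\sum_{y}C[x,y]=1$ for each $x$. A prior on $\mathcal X$ is a probability distribution $\pi$ on $\mathcal X$. The parallel composition (with distinct inputs) $C_1\times C_2$ is the channel from $\mathcal X_1\times\mathcal X_2$ to $\mathcal Y_1\times\mathcal Y_2$ with $(C_1\times C_2)[(x_1,x_2),(y_1,y_2)]=C_1[x_1,y_1]\,C_2[x_2,y_2]$. For a gain function $g:\mathcal W\times\mathcal X\to[0,1]$: $V_g(\pi)=\max_{w\in\mathcal W}\sum_{x}\pi[x]g(w,x)$, $V_g(\pi,C)=\sum_{y}\max_{w\in\mathcal W}\sum_x\pi[x]C[x,y]g(w,x)$, $H_g(\pi)=-\log V_g(\pi)$, $H_g(\pi,C)=-\log V_g(\pi,C)$, and the $g$-leakage is $I_g(\pi,C)=H_g(\pi)-H_g(\pi,C)$. Logarithms are to base 2. A joint gain function $g$ for $g_1,g_2$ is required to satisfy: $g((w_1,w_2),(x_1,x_2))=0$ if and only if $g_1(w_1,x_1)g_2(w_2,x_2)=0$ (no other relation is assumed). The marginals of $\pi$ on $\mathcal X_1\times\mathcal X_2$ are $\pi_1[x_1]=\sum_{x_2}\pi[x_1,x_2]$ and $\pi_2[x_2]=\sum_{x_1}\pi[x_1,x_2]$. $\pi$ is jointly supported if for all $x_1,x_2$, $\pi_1[x_1]\pi_2[x_2]\ne 0$ implies $\pi[x_1,x_2]\neq 0$. For $w_1\in\mathcal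 W_1,w_2\in\mathcal W_2$ let $\mathcal S_{w_1,w_2}=\{(x_1,x_2):\pi[x_1,x_2]\,g((w_1,w_2),(x_1,x_2))\ne0\}$. Define $M^{\min}_{g,\pi}$ (resp. $M^{\max}_{g,\pi}$) as the minimum (resp. maximum), over all $(w_1,w_2)\in\mathcal W_1\times\mathcal W_2$ and all $(x_1,x_2)\in\mathcal S_{w_1,w_2}$, of $$\frac{\pi_1[x_1]g_1(w_1,x_1)\cdot\pi_2[x_2]g_2(w_2,x_2)}{\pi[x_1,x_2]\cdot g((w_1,w_2),(x_1,x_2))}.$$ Pairs $(w_1,w_2)$ with $\mathcal S_{w_1,w_2}=\emptyset$ are ignored; $V_g(\pi)>0$ guarantees that some $\mathcal S_{w_1,w_2}$ is nonempty. *)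

(* Defs.v *)
From HB Require Import structures.
From mathcomp Require Import all_boot all_order all_algebra.
From mathcomp Require Import reals exp.

Set Implicit Arguments.
Unset Strict Implicit.
Unset Printing Implicit Defensive.

Import Order.TTheory GRing.Theory Num.Theory.
Local Open Scope ring_scope.

Section FiniteExtrema.
Variables (R : realType) (I : finType).
Implicit Types (P : pred I) (F : I -> R).

(* Largest and smallest value of F on P; both are 0, by convention, when no
   index satisfies P. *)
Definition fmax P F : R :=
  if [pick i | P i] is Some i0 then F [arg max_(i > i0 | P i) F i]%O else 0.

Definition fmin P F : R :=
  if [pick i | P i] is Some i0 then F [arg min_(i < i0 | P i) F i]%O else 0.

Lemma fmaxP P F i0 : P i0 ->
  exists2 i, P i & fmax P F = F i /\ forall j, P j -> F j <= F i.
Proof.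
rewrite /fmax => Pi0; case: pickP => [k Pk|/(_ i0)]; last by rewrite Pi0.
by case: arg_maxP => // i Pi ub; exists i.
Qed.

Lemma fminP P F i0 : P i0 ->
  exists2 i, P i & fmin P F = F i /\ forall j, P j -> F i <= F j.
Proof.
rewrite /fmin => Pi0; case: pickP => [k Pk|/(_ i0)]; last by rewrite Pi0.
by case: arg_minP => // i Pi lb; exists i.
Qed.

End FiniteExtrema.

Definition log2 (R : realType) (x : R) : R := ln x / ln 2.

Definition is_prior (R : realType) (X : finType) (pi : X -> R) : Prop :=
  (forall x, 0 <= pi x) /\ \sum_x pi x = 1.

Definition is_channel (R : realType) (X Y : finType) (C : X -> Y -> R) : Prop :=
  (forall x y, 0 <= C x y) /\ (forall x, \sum_y C x y = 1).

Definition is_gain (R : realType) (W X : finType) (g : W -> X -> R) : Prop :=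
  forall w x, 0 <= g w x <= 1.

Section Leakage.
Variables (R : realType) (W X Y : finType).
Variables (g : W -> X -> R) (pi : X -> R) (C : X -> Y -> R).

Definition prior_vuln : R := fmax predT (fun w => \sum_x pi x * g w x).

Definition post_vuln : R :=
  \sum_y fmax predT (fun w => \sum_x pi x * C x y * g w x).

Definition prior_entropy : R := - log2 prior_vuln.

Definition post_entropy : R := - log2 post_vuln.

Definition leakage : R := prior_entropy - post_entropy.

End Leakage.

Section Joint.
Variables (R : realType) (X1 X2 : finType).

Definition par_channel (Y1 Y2 : finType) (C1 : X1 -> Y1 -> R)
    (C2 : X2 -> Y2 -> R) : X1 * X2 -> Y1 * Y2 -> R :=
  fun x y => C1 x.1 y.1 * C2 x.2 y.2.

Definition marginal1 (pi : X1 * X2 -> R) : X1 -> R :=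
  fun x1 => \sum_x2 pi (x1, x2).

Definition marginal2 (pi : X1 * X2 -> R) : X2 -> R :=
  fun x2 => \sum_x1 pi (x1, x2).

Definition jointly_supported (pi : X1 * X2 -> R) : Prop :=
  forall x1 x2,
    marginal1 pi x1 * marginal2 pi x2 != 0 -> pi (x1, x2) != 0.

Variables (W1 W2 : finType).

Definition is_joint_gain (g1 : W1 -> X1 -> R) (g2 : W2 -> X2 -> R)
    (g : W1 * W2 -> X1 * X2 -> R) : Prop :=
  is_gain g /\
  forall w1 w2 x1 x2,
    g (w1, w2) (x1, x2) = 0 <-> g1 w1 x1 * g2 w2 x2 = 0.

Variables (g1 : W1 -> X1 -> R) (g2 : W2 -> X2 -> R).
Variables (g : W1 * W2 -> X1 * X2 -> R) (pi : X1 * X2 -> R).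

Definition gain_support (w : W1 * W2) : {set X1 * X2} :=
  [set x | pi x * g w x != 0].

(* p = ((w1, w2), (x1, x2)) *)
Definition gain_ratio (p : (W1 * W2) * (X1 * X2)) : R :=
  (marginal1 pi p.2.1 * g1 p.1.1 p.2.1 *
   (marginal2 pi p.2.2 * g2 p.1.2 p.2.2)) / (pi p.2 * g p.1 p.2).

Definition Mmin : R := fmin (fun p => p.2 \in gain_support p.1) gain_ratio.

Definition Mmax : R := fmax (fun p => p.2 \in gain_support p.1) gain_ratio.

End Joint.

(* Main.v *)
Require Import Defs.
From HB Require Import structures.
From mathcomp Require Import all_boot all_order all_algebra.
From mathcomp Require Import reals exp ring lra.

Set Implicit Arguments.
Unset Strict Implicit.
Unset Printing Implicit Defensive.

Import Order.TTheory GRing.Theory Num.Theory.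
Local Open Scope ring_scope.

(* Let m and M be the extremal gain ratios. Then m (pi g) <= (pi1 g1) (pi2 g2)
   <= M (pi g) holds for all arguments, including those where pi g vanishes:
   joint support and the zero condition on g make the middle term vanish too.
   Maximising over guesses and summing over outputs are monotone, and both
   factor on products, so the same sandwich holds for the prior and for the
   posterior vulnerabilities. The theorem is the logarithm of the quotient of
   these two sandwiches. *)

(** * Maxima over a nonempty finite type *)

Section Fmax.
Context {R : realType} {I : finType}.
Implicit Types F : I -> R.

Lemma fmax_ub F i : F i <= fmax predT F.
Proof. by have [j _ [-> ]] := @fmaxP R I predT F i isT; apply. Qed.

Lemma fmax_attained F : (0 < #|I|)%N -> exists i, fmax predT F = F i.
Proof.
by case/card_gt0P=> i0 _; have [i _ [-> _]] := @fmaxP R I predT F i0 isT; exists i.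
Qed.

End Fmax.

(** * Prior and posterior vulnerability *)

Section Vulnerability.
Context {R : realType} {W X Y : finType}.
Variables (g : W -> X -> R) (pi : X -> R) (C : X -> Y -> R).

(** Each output contributes the vulnerability of an unnormalised joint slice of [pi] and [C]; bounds
    on [prior_vuln] for arbitrary weights therefore transfer to posteriors output by output. *)
Lemma post_vulnE :
  post_vuln g pi C = \sum_y prior_vuln g (fun x => pi x * C x y).
Proof. by []. Qed.

(** An adversary may ignore the output and always make the guess that is best a priori. This carries
    positivity from prior to posterior vulnerabilities, so that their logarithms are meaningful. *)
Lemma prior_vuln_le_post : (0 < #|W|)%N -> is_channel C ->
  prior_vuln g pi <= post_vuln g pi C.
Proof.
move=> hW [_ C1].
have [w Ew] := fmax_attained (fun w => \sum_x pi x * g w x) hW.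
rewrite /prior_vuln Ew.
(* Each row of [C] sums to 1, so the gain of the fixed guess [w] splits over outputs. *)
have -> : \sum_x pi x * g w x = \sum_y \sum_x pi x * C x y * g w x.
  rewrite exchange_big /=; apply: eq_bigr => x _.
  by rewrite -mulr_suml -mulr_sumr C1 mulr1.
apply: ler_sum => y _.
exact: (fmax_ub (fun w => \sum_x pi x * C x y * g w x)).
Qed.

Lemma prior_vuln_ge0 : (0 < #|W|)%N -> (forall w x, 0 <= g w x) ->
  (forall x, 0 <= pi x) -> 0 <= prior_vuln g pi.
Proof.
move=> hW g0 pi0; rewrite /prior_vuln.
have [w ->] := fmax_attained (fun w => \sum_x pi x * g w x) hW.
by apply: sumr_ge0 => x _; rewrite mulr_ge0.
Qed.

End Vulnerability.

(** * Vulnerabilities of products, for weights comparable up to a factor [c] *)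

Section Product.
Context {R : realType} {X1 X2 W1 W2 : finType}.
Variables (g1 : W1 -> X1 -> R) (g2 : W2 -> X2 -> R).
Variables (g : W1 * W2 -> X1 * X2 -> R).
Hypotheses (hW1 : (0 < #|W1|)%N) (hW2 : (0 < #|W2|)%N).
Hypotheses (g1_ge0 : forall w x, 0 <= g1 w x) (g2_ge0 : forall w x, 0 <= g2 w x).

Let sum_prod (a1 : X1 -> R) (a2 : X2 -> R) :
  (\sum_x a1 x) * (\sum_x a2 x) = \sum_x a1 x.1 * a2 x.2.
Proof. by rewrite big_distrlr /= pair_bigA. Qed.

Section Prior.
Variables (rho1 : X1 -> R) (rho2 : X2 -> R) (rho : X1 * X2 -> R) (c : R).
Hypotheses (rho1_ge0 : forall x, 0 <= rho1 x) (rho2_ge0 : forall x, 0 <= rho2 x).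

(** The components of an optimal joint guess are admissible, perhaps suboptimal, guesses for the two
    factors. The weights are not assumed normalised, so that slices of a posterior qualify. *)
Lemma prior_vuln_le_prod :
  (forall w x, c * (rho x * g w x) <=
     rho1 x.1 * g1 w.1 x.1 * (rho2 x.2 * g2 w.2 x.2)) ->
  c * prior_vuln g rho <= prior_vuln g1 rho1 * prior_vuln g2 rho2.
Proof.
move=> le_c.
have hW : (0 < #|{: W1 * W2}|)%N by rewrite card_prod muln_gt0 hW1.
rewrite {1}/prior_vuln.
have [w ->] := fmax_attained (fun w => \sum_x rho x * g w x) hW.
apply: (@le_trans _ _ ((\sum_x rho1 x * g1 w.1 x) * (\sum_x rho2 x * g2 w.2 x))).
  by rewrite sum_prod mulr_sumr; apply: ler_sum.
apply: ler_pM; try by apply: sumr_ge0 => x _; rewrite mulr_ge0.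
- exact: (fmax_ub (fun w => \sum_x rho1 x * g1 w x)).
- exact: (fmax_ub (fun w => \sum_x rho2 x * g2 w x)).
Qed.

(** Conversely, two separately optimal guesses form one admissible joint guess. *)
Lemma prior_vuln_ge_prod : 0 <= c ->
  (forall w x, rho1 x.1 * g1 w.1 x.1 * (rho2 x.2 * g2 w.2 x.2) <=
     c * (rho x * g w x)) ->
  prior_vuln g1 rho1 * prior_vuln g2 rho2 <= c * prior_vuln g rho.
Proof.
move=> c0 le_c; rewrite {1 2}/prior_vuln.
have [w1 ->] := fmax_attained (fun w => \sum_x rho1 x * g1 w x) hW1.
have [w2 ->] := fmax_attained (fun w => \sum_x rho2 x * g2 w x) hW2.
apply: (@le_trans _ _ (c * \sum_x rho x * g (w1, w2) x)).
  by rewrite sum_prod mulr_sumr; apply: ler_sum => x _; apply: (le_c (w1, w2)).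
apply: ler_wpM2l => //.
exact: (fmax_ub (fun w => \sum_x rho x * g w x)).
Qed.

End Prior.

Section Posterior.
Context {Y1 Y2 : finType}.
Variables (pi1 : X1 -> R) (pi2 : X2 -> R) (pi : X1 * X2 -> R) (c : R).
Variables (C1 : X1 -> Y1 -> R) (C2 : X2 -> Y2 -> R).
Hypotheses (pi1_ge0 : forall x, 0 <= pi1 x) (pi2_ge0 : forall x, 0 <= pi2 x).
Hypotheses (C1_ge0 : forall x y, 0 <= C1 x y) (C2_ge0 : forall x y, 0 <= C2 x y).

Lemma post_vuln_le_prod :
  (forall w x, c * (pi x * g w x) <=
     pi1 x.1 * g1 w.1 x.1 * (pi2 x.2 * g2 w.2 x.2)) ->
  c * post_vuln g pi (par_channel C1 C2) <=
    post_vuln g1 pi1 C1 * post_vuln g2 pi2 C2.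
Proof.
move=> le_c; rewrite !post_vulnE big_distrlr /= pair_bigA mulr_sumr /=.
apply: ler_sum => y _; apply: prior_vuln_le_prod => [x|x|w x].
- by rewrite mulr_ge0.
- by rewrite mulr_ge0.
(* Scaling by the channel entries turns the hypothesis on priors into the one needed for the slice
   at output [y]. *)
have := ler_wpM2r (mulr_ge0 (C1_ge0 x.1 y.1) (C2_ge0 x.2 y.2)) (le_c w x).
rewrite /par_channel; congr (_ <= _); ring.
Qed.

Lemma post_vuln_ge_prod : 0 <= c ->
  (forall w x, pi1 x.1 * g1 w.1 x.1 * (pi2 x.2 * g2 w.2 x.2) <=
     c * (pi x * g w x)) ->
  post_vuln g1 pi1 C1 * post_vuln g2 pi2 C2 <=
    c * post_vuln g pi (par_channel C1 C2).
Proof.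
move=> c0 le_c; rewrite !post_vulnE big_distrlr /= pair_bigA mulr_sumr /=.
apply: ler_sum => y _; apply: prior_vuln_ge_prod => // w x.
have := ler_wpM2r (mulr_ge0 (C1_ge0 x.1 y.1) (C2_ge0 x.2 y.2)) (le_c w x).
rewrite /par_channel; congr (_ <= _); ring.
Qed.

End Posterior.

End Product.

(** * The extremal gain ratios as comparison constants *)

Section GainRatio.
Context {R : realType} {X1 X2 W1 W2 : finType}.
Variables (g1 : W1 -> X1 -> R) (g2 : W2 -> X2 -> R).
Variables (g : W1 * W2 -> X1 * X2 -> R) (pi : X1 * X2 -> R).
Hypotheses (g1_ge0 : forall w x, 0 <= g1 w x) (g2_ge0 : forall w x, 0 <= g2 w x).
Hypotheses (hg : is_joint_gain g1 g2 g) (pi_ge0 : forall x, 0 <= pi x).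

Let prodg (w : W1 * W2) (x : X1 * X2) : R :=
  marginal1 pi x.1 * g1 w.1 x.1 * (marginal2 pi x.2 * g2 w.2 x.2).

Let in_support : pred ((W1 * W2) * (X1 * X2)) :=
  fun p => p.2 \in gain_support g pi p.1.

Lemma marginal1_ge0 x : 0 <= marginal1 pi x.
Proof. exact: sumr_ge0. Qed.

Lemma marginal2_ge0 x : 0 <= marginal2 pi x.
Proof. exact: sumr_ge0. Qed.

Lemma le_marginal1 x : pi x <= marginal1 pi x.1.
Proof.
case: x => x1 x2; rewrite /marginal1 (bigD1 x2) //= lerDl.
exact: sumr_ge0.
Qed.

Lemma le_marginal2 x : pi x <= marginal2 pi x.2.
Proof.
case: x => x1 x2; rewrite /marginal2 (bigD1 x1) //= lerDl.
exact: sumr_ge0.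
Qed.

Lemma joint_weight_gt0 w x : x \in gain_support g pi w -> 0 < pi x * g w x.
Proof.
rewrite inE lt_def => -> /=; apply: mulr_ge0 => //.
by have [/(_ w x)/andP[]] := hg.
Qed.

(** Both marginals dominate [pi x], which is positive on the support, and the zero condition on [g]
    passes nonvanishing from [g] to [g1] and [g2]. *)
Lemma gain_ratio_gt0 w x : x \in gain_support g pi w ->
  0 < gain_ratio g1 g2 g pi (w, x).
Proof.
move=> Sx; have pig_gt0 := joint_weight_gt0 Sx.
move: Sx; rewrite inE mulf_eq0 negb_or => /andP[pi_neq0 g_neq0].
have pi_gt0 : 0 < pi x by rewrite lt_def pi_neq0 pi_ge0.
have gg_neq0 : g1 w.1 x.1 * g2 w.2 x.2 != 0.
  apply: contra_neq g_neq0 => gg0.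
  case: w x {pig_gt0 pi_neq0 pi_gt0} gg0 => [w1 w2] [x1 x2].
  by case: hg => _ /(_ w1 w2 x1 x2)[_]; apply.
have m1_gt0 := lt_le_trans pi_gt0 (le_marginal1 x).
have m2_gt0 := lt_le_trans pi_gt0 (le_marginal2 x).
move: gg_neq0; rewrite mulf_eq0 negb_or => /andP[g1_neq0 g2_neq0].
rewrite /gain_ratio divr_gt0 //= !mulr_gt0 //.
  by rewrite lt_def g1_neq0 g1_ge0.
by rewrite lt_def g2_neq0 g2_ge0.
Qed.

Lemma prod_weight_eq0 w x : jointly_supported pi ->
  x \notin gain_support g pi w -> prodg w x = 0.
Proof.
case: w x => [w1 w2] [x1 x2] hsupp.
rewrite inE negbK mulf_eq0 /prodg /= mulrACA => /orP[/eqP pi0|/eqP g0].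
  suff -> : marginal1 pi x1 * marginal2 pi x2 = 0 by rewrite mul0r.
  by apply/eqP/negPn/negP => /hsupp; rewrite pi0 eqxx.
by case: hg => _ /(_ w1 w2 x1 x2)[/(_ g0) -> _]; rewrite mulr0.
Qed.

Lemma Mmin_le w x : jointly_supported pi ->
  Mmin g1 g2 g pi * (pi x * g w x) <= prodg w x.
Proof.
move=> hsupp; have [Sx|nSx] := boolP (x \in gain_support g pi w).
  rewrite -ler_pdivlMr ?joint_weight_gt0 //.
  have [q _ [M_E /(_ (w, x) Sx)]] :=
    @fminP R _ in_support (gain_ratio g1 g2 g pi) (w, x) Sx.
  by rewrite -M_E.
by rewrite prod_weight_eq0 //; move: nSx; rewrite inE negbK => /eqP->; rewrite mulr0.
Qed.

Lemma le_Mmax w x : jointly_supported pi ->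
  prodg w x <= Mmax g1 g2 g pi * (pi x * g w x).
Proof.
move=> hsupp; have [Sx|nSx] := boolP (x \in gain_support g pi w).
  rewrite -ler_pdivrMr ?joint_weight_gt0 //.
  have [q _ [M_E /(_ (w, x) Sx)]] :=
    @fmaxP R _ in_support (gain_ratio g1 g2 g pi) (w, x) Sx.
  by rewrite -M_E.
by rewrite prod_weight_eq0 //; move: nSx; rewrite inE negbK => /eqP->; rewrite mulr0.
Qed.

(** A support point rules out the default value 0 of [fmin] and [fmax], making [Mmin] and [Mmax]
    attained ratios, hence positive. *)
Lemma gain_support_inhabited : (0 < #|W1|)%N -> (0 < #|W2|)%N ->
  0 < prior_vuln g pi -> exists w x, x \in gain_support g pi w.
Proof.
move=> hW1 hW2.
have hW : (0 < #|{: W1 * W2}|)%N by rewrite card_prod muln_gt0 hW1.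
rewrite /prior_vuln; have [w ->] := fmax_attained (fun w => \sum_x pi x * g w x) hW.
have [/existsP[x Sx] _|nS] := boolP [exists x, x \in gain_support g pi w].
  by exists w, x.
rewrite big1 ?ltxx // => x _; move: nS; rewrite negb_exists => /forallP/(_ x).
by rewrite inE negbK => /eqP.
Qed.

Lemma Mmin_gt0 w x : x \in gain_support g pi w -> 0 < Mmin g1 g2 g pi.
Proof.
move=> Sx; have [[w' x'] Sx' [M_E _]] :=
  @fminP R _ in_support (gain_ratio g1 g2 g pi) (w, x) Sx.
by rewrite [Mmin _ _ _ _]M_E; apply: gain_ratio_gt0.
Qed.

Lemma Mmax_gt0 w x : x \in gain_support g pi w -> 0 < Mmax g1 g2 g pi.
Proof.
move=> Sx; have [[w' x'] Sx' [M_E _]] :=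
  @fmaxP R _ in_support (gain_ratio g1 g2 g pi) (w, x) Sx.
by rewrite [Mmax _ _ _ _]M_E; apply: gain_ratio_gt0.
Qed.

End GainRatio.

(** * Binary logarithm *)

Section Log2.
Context {R : realType}.
Implicit Types x y : R.

Lemma log2M x y : 0 < x -> 0 < y -> log2 (x * y) = log2 x + log2 y.
Proof. by move=> x0 y0; rewrite /log2 lnM ?posrE // mulrDl. Qed.

Lemma log2V x : 0 < x -> log2 x^-1 = - log2 x.
Proof. by move=> x0; rewrite /log2 lnV ?posrE // mulNr. Qed.

Lemma ler_log2 x y : 0 < x -> x <= y -> log2 x <= log2 y.
Proof.
move=> x0 xy; rewrite /log2 ler_wpM2r ?invr_ge0 ?ln_ge0 ?ler1n //.
by rewrite ler_ln ?posrE // (lt_le_trans x0).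
Qed.

End Log2.

Theorem theorem3p9 (R : realType) (X1 X2 Y1 Y2 W1 W2 : finType)
  (hX1 : (0 < #|X1|)%N) (hX2 : (0 < #|X2|)%N)
  (hY1 : (0 < #|Y1|)%N) (hY2 : (0 < #|Y2|)%N)
  (hW1 : (0 < #|W1|)%N) (hW2 : (0 < #|W2|)%N)
  (g1 : W1 -> X1 -> R) (g2 : W2 -> X2 -> R) (g : W1 * W2 -> X1 * X2 -> R)
  (hg1 : is_gain g1) (hg2 : is_gain g2) (hg : is_joint_gain g1 g2 g)
  (pi : X1 * X2 -> R) (hpi : is_prior pi) (hsupp : jointly_supported pi)
  (hV : 0 < prior_vuln g pi)
  (C1 : X1 -> Y1 -> R) (C2 : X2 -> Y2 -> R)
  (hC1 : is_channel C1) (hC2 : is_channel C2) :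
  leakage g pi (par_channel C1 C2) >=
    leakage g1 (marginal1 pi) C1 + leakage g2 (marginal2 pi) C2
    - log2 (Mmax g1 g2 g pi / Mmin g1 g2 g pi)
  /\
  leakage g pi (par_channel C1 C2) <=
    leakage g1 (marginal1 pi) C1 + leakage g2 (marginal2 pi) C2
    + log2 (Mmax g1 g2 g pi / Mmin g1 g2 g pi).
Proof.
have g1_ge0 w x : 0 <= g1 w x by case/andP: (hg1 w x).
have g2_ge0 w x : 0 <= g2 w x by case/andP: (hg2 w x).
have [[pi_ge0 _] [C1_ge0 _] [C2_ge0 _]] := And3 hpi hC1 hC2.
have [w [x Sx]] := gain_support_inhabited hW1 hW2 hV.
have m_gt0 := Mmin_gt0 g1_ge0 g2_ge0 hg pi_ge0 Sx.
have M_gt0 := Mmax_gt0 g1_ge0 g2_ge0 hg pi_ge0 Sx.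
have le_m w' x' := Mmin_le hg pi_ge0 w' x' hsupp.
have le_M w' x' := le_Mmax hg pi_ge0 w' x' hsupp.
have pi1_ge0 := marginal1_ge0 pi_ge0.
have pi2_ge0 := marginal2_ge0 pi_ge0.
have hW : (0 < #|{: W1 * W2}|)%N by rewrite card_prod muln_gt0 hW1.
have hC : is_channel (par_channel C1 C2).
  split=> [x' y|[x1 x2]]; first exact: mulr_ge0.
  rewrite -(pair_bigA _ (fun y1 y2 => C1 x1 y1 * C2 x2 y2)) -big_distrlr /=.
  by rewrite hC1.2 hC2.2 mulr1.
have mA := prior_vuln_le_prod hW1 hW2 g1_ge0 g2_ge0 pi1_ge0 pi2_ge0 le_m.
have AM := prior_vuln_ge_prod hW1 hW2 (ltW M_gt0) le_M.
have mB := post_vuln_le_prod hW1 hW2 g1_ge0 g2_ge0 pi1_ge0 pi2_ge0 C1_ge0 C2_ge0 le_m.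
have BM := post_vuln_ge_prod hW1 hW2 C1_ge0 C2_ge0 (ltW M_gt0) le_M.
have B_ge := prior_vuln_le_post g pi hW hC.
have B1_ge := prior_vuln_le_post g1 (marginal1 pi) hW1 hC1.
have B2_ge := prior_vuln_le_post g2 (marginal2 pi) hW2 hC2.
have A1_ge0 := prior_vuln_ge0 hW1 g1_ge0 pi1_ge0.
have A2_ge0 := prior_vuln_ge0 hW2 g2_ge0 pi2_ge0.
rewrite /leakage /prior_entropy /post_entropy.
(* Only inequalities between real numbers remain: [A], [A1], [A2] are the prior vulnerabilities,
   [B], [B1], [B2] the posterior ones. *)
move: (prior_vuln g pi) (prior_vuln g1 _) (prior_vuln g2 _) (post_vuln g _ _)
  (post_vuln g1 _ _) (post_vuln g2 _ _) (Mmin _ _ _ _) (Mmax _ _ _ _) hV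
  m_gt0 M_gt0 mA AM mB BM B_ge B1_ge B2_ge A1_ge0 A2_ge0.
move=> A A1 A2 B B1 B2 m M A_gt0 m_gt0 M_gt0 mA AM mB BM B_ge B1_ge B2_ge A1_ge0 A2_ge0.
(* Positivity of the marginal vulnerabilities comes from [A] through the lower half of the prior
   sandwich. *)
have A12_gt0 : 0 < A1 * A2 by apply: lt_le_trans mA; rewrite mulr_gt0.
have A1_gt0 : 0 < A1.
  by rewrite lt_def A1_ge0 andbT; apply: contraTneq A12_gt0 => ->; rewrite mul0r ltxx.
have A2_gt0 : 0 < A2.
  by rewrite lt_def A2_ge0 andbT; apply: contraTneq A12_gt0 => ->; rewrite mulr0 ltxx.
have B_gt0 := lt_le_trans A_gt0 B_ge.
have B1_gt0 := lt_le_trans A1_gt0 B1_ge.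
have B2_gt0 := lt_le_trans A2_gt0 B2_ge.
(* The lower bound on leakage combines [mA] with [BM], the upper bound [AM] with [mB]; each costs
   one factor [M / m]. *)
move: (ler_log2 (mulr_gt0 m_gt0 A_gt0) mA) (ler_log2 A12_gt0 AM)
  (ler_log2 (mulr_gt0 m_gt0 B_gt0) mB) (ler_log2 (mulr_gt0 B1_gt0 B2_gt0) BM).
rewrite !log2M ?invr_gt0 // log2V //.
by split; lra.
Qed.
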